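(* Let $\Phi$ be a continuous semiflow on a Banach space $(X,\|\cdot\|_X)$ which is eventually compact and possesses a global attractor $\Gamma$, and suppose that $\Phi$ is uniformly eventually strongly monotone (UESM) with respect to nested invariant cones (NICs) $\{C^i\}_{i=0}^{N}$. Let $\mu$ be an invariant Borel probability measure of $\Phi$ and let $B$ be a connected component of $\operatorname{supp}(\mu)$. Then there exists $j$ with $0<j\le N$ such that $B$ is strongly ordered with $C^i$ for every $i=j,\dots,N$ and unordered with $C^i$ for every $i=0,\dots,j-1$. Moreover, suppose that there is a closed linear subspace $\Pi\subset X$ of codimension $d$ such that, for every $1\le i\le N$ and all distinct $x,y\in\mathcal{B}(\Phi)$, the following implication holds: if for every $s>0$ there exist $\tilde x,\tilde y\in\mathcal{B}(\Phi)$ with $\Phi_s(\tilde x)=x$, $\Phi_s(\tilde y)=y$ and $\Phi_t(\tilde x)-\Phi_t(\tilde y)\in(C^i\setminus C^{i-1})\cup\{0\}$ for all $t\ge0$, then $x-y\notin\Pi$. Then $B$ is homeomorphic to a compact invariant connected set in $\mathbb{R}^d$.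
   Context: **Semiflows.** A continuous semiflow on a Banach space $X$ is a continuous map $\Phi:[0,\infty)\times X\to X$, $\Phi_t(x)=\Phi(t,x)$, with $\Phi_0=\mathrm{id}$ and $\Phi_t\circ\Phi_s=\Phi_{t+s}$ for $t,s\ge0$. It is eventually compact if there is $\tau>0$ such that $\Phi_\tau(D)$ is relatively compact for every bounded $D\subset X$. A set $A$ is invariant if $\Phi_t(A)=A$ for all $t\ge0$. A global attractor is a nonempty compact invariant set $\Gamma\subset X$ with $\lim_{t\to+\infty}\sup_{a\in\Phi_t(D)}\inf_{b\in\Gamma}\|a-b\|_X=0$ for every bounded $D\subset X$. The $\omega$-limit set is $\omega(x)=\bigcap_{t\ge0}\overline{\bigcup_{s\ge t}\{\Phi_s(x)\}}$. The point $x$ is recurrent if $x\in\omega(x)$; $\mathcal{R}(\Phi)$ is the set of recurrent points, and the Birkhoff center is $\mathcal{B}(\Phi)=\overline{\mathcal{R}(\Phi)}$. **Invariant measures.** A Borel probability measure $\mu$ on $X$ is invariant under $\Phi$ if $\mu(\Phi_t^{-1}(A))=\mu(A)$ for every Borel set $A\subset X$ and $t\ge0$. $\operatorname{supp}(\mu)$ is the complement of the union of all open sets of $\mu$-measure zero. **Cones.** A closed set $C\subset X$ is a $k$-cone if $lv\in C$ for all $v\in C$, $l\in\mathbb{R}$, and $\max\{\dim W: W\subset C \text{ a linear subspace}\}=k$. It is solid if $\operatorname{Int}C\ne\emptyset$. (Cones are not assumed convex.) A set $S\subset X$ is unordered with $C$ if there are no distinct $x,y\in S$ with $x-y\in C$;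 it is strongly ordered with $C$ if $x-y\in\operatorname{Int}C$ for all distinct $x,y\in S$. **UESM.** $\Phi$ is UESM with respect to a solid cone $C$ if there is $T(C)>0$ such that $x-y\in C\setminus\{0\}$ implies $\Phi_t(x)-\Phi_t(y)\in\operatorname{Int}C$ for all $t\ge T(C)$. **NICs.** A sequence of closed sets $\{C^i\}_{i=0}^N$, $N\in\mathbb{N}\cup\{+\infty\}$, is called NICs for $\Phi$ if: (i) $\{0\}=C^0\subset\dots\subset C^{i-1}\subset C^i\subset\dots\subset C^N=X$; (ii) $C^i$ is a solid $k_i$-cone for all $0<i<N$, with $k_{i-1}<k_i$ for all $1<i<N$; (iii) for each $1\le i<N$ there is $t_*^i\ge0$ such that $x-y\in C^i$ implies $\Phi_t(x)-\Phi_t(y)\in C^i$ for every $t\ge t_*^i$. $\Phi$ is UESM with respect to the NICs if it is UESM with respect to $C^i$ for every $1\le i<N$. **Conventions.** If $N=+\infty$, the indices are $0,1,2,\dots$ together with $\infty$ (with $C^\infty=X$); $j=\infty$ is allowed, in which case ''$i=0,\dots,j-1$'' means all finite $i$; and $C^{\infty-1}$ means $\bigcup_{i<\infty}C^i$. ''Invariant'' for the image set in $\mathbb{R}^d$ refers to the semiflow induced on it by transporting $\Phi|_B$ through the homeomorphism. *)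

(* Defs.v *)
(* MathComp / MathComp-Analysis development. *)
From HB Require Import structures.
From mathcomp Require Import all_boot all_order all_algebra.
From mathcomp Require Import all_classical all_reals all_analysis.
Set Implicit Arguments.
Unset Strict Implicit.
Unset Printing Implicit Defensive.
Import Order.TTheory GRing.Theory Num.Theory numFieldNormedType.Exports.
Local Open Scope classical_set_scope.
Local Open Scope ring_scope.

(** Extended natural numbers *)

Variant enat := Fin of nat | Infty.

Definition eleq (i j : enat) : bool :=
  match i, j with
  | _, Infty => true
  | Infty, Fin _ => false
  | Fin m, Fin n => (m <= n)%N
  end.

Definition eltn (i j : enat) : bool := ~~ eleq j i.

(** Semiflows.  A semiflow is a total function of the time [t : R]; only its
    values at [0 <= t] are meaningful. *)

Definition semiflow (R : realType) (X : normedModType R) (Phi : R -> X -> X) :=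
  [/\ {within [set p : R * X | 0 <= p.1], continuous (fun p => Phi p.1 p.2)},
      forall x, Phi 0 x = x
    & forall (t s : R) (x : X), 0 <= t -> 0 <= s -> Phi t (Phi s x) = Phi (t + s) x].

Definition eventually_compact (R : realType) (X : normedModType R)
    (Phi : R -> X -> X) :=
  exists2 tau : R, 0 < tau &
    forall D : set X, bounded_set D -> precompact (Phi tau @` D).

Definition flow_invariant (R : realType) (T : Type) (Phi : R -> T -> T)
    (A : set T) :=
  forall t : R, 0 <= t -> Phi t @` A = A.

(* The semidistance is taken in the extended reals, so that it is +oo (and not
   a default value) when the supremum is infinite.  The set [D] is nonempty
   because [ereal_sup set0 = -oo]; for [D = set0] there is nothing to attract. *)
Definition global_attractor (R : realType) (X : normedModType R)
    (Phi : R -> X -> X) (G : set X) :=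
  [/\ G !=set0, compact G, flow_invariant Phi G
    & forall D : set X, bounded_set D -> D !=set0 ->
        ereal_sup [set ereal_inf [set (`|a - b|)%:E | b in G]
                  | a in Phi t @` D] @[t --> +oo] --> 0%E].

Definition omega_limit (R : realType) (X : normedModType R)
    (Phi : R -> X -> X) (x : X) : set X :=
  \bigcap_(t in [set t : R | 0 <= t])
    closure (\bigcup_(s in [set s : R | t <= s]) [set Phi s x]).

Definition recurrent (R : realType) (X : normedModType R)
    (Phi : R -> X -> X) : set X :=
  [set x | omega_limit Phi x x].

Definition birkhoff_center (R : realType) (X : normedModType R)
    (Phi : R -> X -> X) : set X :=
  closure (recurrent Phi).

(** Borel probability measures *)

Definition invariant_measure (R : realType) (X : normedModType R)
    (Phi : R -> X -> X) (mu : probability (g_sigma_algebraType (@open X)) R) :=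
  forall A : set (g_sigma_algebraType (@open X)), measurable A ->
    forall t : R, 0 <= t -> mu (Phi t @^-1` A) = mu A.

Definition supp (R : realType) (X : normedModType R)
    (mu : probability (g_sigma_algebraType (@open X)) R) : set X :=
  ~` \bigcup_(U in [set U : set X | open U /\ mu U = 0%E]) U.

Definition is_component (T : topologicalType) (A B : set T) :=
  exists2 x, A x & B = connected_component A x.

(** Linear subspaces, dimension and codimension *)

Definition linear_subspace (R : realType) (X : lmodType R) (W : set X) :=
  GRing.submod_closed (mem W).

(* [e] is a basis of [W] *)
Definition has_dim (R : realType) (X : lmodType R) (W : set X) (n : nat) :=
  exists2 e : 'I_n -> X, forall i, W (e i) &
    forall x, W x -> exists! c : 'rV[R]_n, x = \sum_(i < n) c ord0 i *: e i.

(* The classes of [e] form a basis of the quotient of [X] by [P]. *)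
Definition has_codim (R : realType) (X : lmodType R) (P : set X) (d : nat) :=
  exists e : 'I_d -> X,
    forall x, exists! c : 'rV[R]_d, P (x - \sum_(i < d) c ord0 i *: e i).

(** Cones *)

Definition kcone (R : realType) (X : normedModType R) (k : nat) (C : set X) :=
  [/\ closed C,
      forall (l : R) v, C v -> C (l *: v),
      exists W : set X, [/\ linear_subspace W, W `<=` C & has_dim W k]
    & forall W : set X, linear_subspace W -> W `<=` C ->
        exists2 m, (m <= k)%N & has_dim W m].

Definition solid (R : realType) (X : normedModType R) (C : set X) :=
  interior C !=set0.

Definition unordered (R : realType) (X : normedModType R) (C S : set X) :=
  forall x y, S x -> S y -> x <> y -> ~ C (x - y).

Definition strongly_ordered (R : realType) (X : normedModType R)
    (C S : set X) :=
  forall x y, S x -> S y -> x <> y -> interior C (x - y).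

Definition UESM (R : realType) (X : normedModType R) (Phi : R -> X -> X)
    (C : set X) :=
  exists2 T : R, 0 < T &
    forall x y, (C `\ 0) (x - y) ->
      forall t : R, T <= t -> interior C (Phi t x - Phi t y).

(* The set preceding [C i]; the one preceding [C Infty] is the union of all
   the [C (Fin n)].  The value at [Fin 0] is irrelevant. *)
Definition prev_cone (T : Type) (C : enat -> set T) (i : enat) : set T :=
  match i with
  | Fin n => C (Fin n.-1)
  | Infty => \bigcup_n C (Fin n)
  end.

(* Only the sets [C i] with [i <= N] matter.  The length [N] is positive: for
   [N = 0] the chain would collapse to [{0} = X]. *)
Definition NICs (R : realType) (X : normedModType R) (Phi : R -> X -> X)
    (N : enat) (C : enat -> set X) :=
  [/\ eltn (Fin 0) N,
      forall i, eleq i N -> closed (C i),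
      [/\ C (Fin 0) = [set 0], C N = setT
        & forall i, eleq (Fin 1) i -> eleq i N -> prev_cone C i `<=` C i],
      exists k : nat -> nat,
        (forall n, (0 < n)%N -> eltn (Fin n) N ->
           kcone (k n) (C (Fin n)) /\ solid (C (Fin n))) /\
        (forall n, (1 < n)%N -> eltn (Fin n) N -> (k n.-1 < k n)%N)
    & forall i, eleq (Fin 1) i -> eltn i N ->
        exists2 ts : R, 0 <= ts &
          forall x y, C i (x - y) ->
            forall t : R, ts <= t -> C i (Phi t x - Phi t y)].

Definition UESM_NICs (R : realType) (X : normedModType R) (Phi : R -> X -> X)
    (N : enat) (C : enat -> set X) :=
  forall i, eleq (Fin 1) i -> eltn i N -> UESM Phi (C i).

(** Homeomorphisms between subsets, and transport of a semiflow *)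

Definition homeo_on (T U : topologicalType) (A : set T) (K : set U)
    (h : T -> U) (g : U -> T) :=
  [/\ set_fun A K h, set_fun K A g,
      (forall x, A x -> g (h x) = x) /\ (forall y, K y -> h (g y) = y),
      {within A, continuous h} & {within K, continuous g}].

Definition transport (R : realType) (T U : Type) (h : T -> U) (g : U -> T)
    (Phi : R -> T -> T) : R -> U -> U :=
  fun t => h \o Phi t \o g.

(* [Phi] maps [A] into itself, so that it restricts to a semiflow on [A] and
   [transport h g Phi] is the induced semiflow on [K]. *)
Definition homeo_to_invariant (R : realType) (T U : topologicalType)
    (Phi : R -> T -> T) (A : set T) (K : set U) :=
  exists (h : T -> U) (g : U -> T),
    [/\ homeo_on A K h g,
        forall t : R, 0 <= t -> Phi t @` A `<=` A
      & flow_invariant (transport h g Phi) K].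

(* Main.v *)
(** Fix one cone [C] of the chain.  If [x, y] lie in the support of [mu] and
    [x - y] is a nonzero vector of [C], strong monotonicity puts
    [Phi_t a - Phi_t b] in [C] for all large [t] and all [(a, b)] near [(x, y)].
    Poincare recurrence for [mu x mu] returns pairs near [(a, b)] to themselves
    at such times, so [a - b] is in [C] for all [(a, b)] of the support near
    [(x, y)].  Hence [x - y] in [C] is an open and closed symmetric relation off
    the diagonal of the support, and a connected subset of the support satisfies
    it for all its pairs of distinct points or for none.  A component
    is invariant, so flowing pairs backward improves [C] to its interior.

    The component is then strictly between two consecutive cones, so the
    projection along [Pi] is injective on it; the projection is continuous and
    the component is compact. *)

Require Import Defs.
From HB Require Import structures.
From mathcomp Require Import all_boot all_order all_algebra.
From mathcomp Require Import all_classical all_reals all_analysis.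
Import Order.TTheory GRing.Theory Num.Theory numFieldNormedType.Exports.
Local Open Scope classical_set_scope.
Local Open Scope ring_scope.

Set Implicit Arguments.
Unset Strict Implicit.

(** * Locally constant relations off the diagonal of a connected set *)

Lemma connected_locally_constant (T : topologicalType) (A Z : set T) :
  connected A ->
  (forall x, A x -> \forall y \near x, A y -> (Z y <-> Z x)) ->
  forall x y, A x -> A y -> Z x -> Z y.
Proof.
move=> cA lcZ x y Ax Ay Zx.
suff AZ : A `&` Z = A by move: Ay; rewrite -{1}AZ => -[].
apply: cA; first by exists x.
- exists (interior [set w | A w -> Z w]); first exact: open_interior.
  apply/seteqP; split=> w [Aw Zw]; split=> //.
    by apply: filterS (lcZ _ Aw) => z h /h ->.
  exact: (interior_subset Zw).
- exists (closure (A `&` Z)); first exact: closed_closure.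
  apply/seteqP; split=> w [Aw Zw]; split=> //.
    by apply: subset_closure; split.
  by have [z [[Az Zz]]] := Zw _ (lcZ _ Aw); move=> /(_ Az) <-.
Qed.

Definition locally_constant_offdiag (T : topologicalType) (B : set T)
    (P : T -> T -> Prop) :=
  forall x y, B x -> B y -> x <> y ->
    \forall a \near x & b \near y, B a -> B b -> (P a b <-> P x y).

(** If [P u v] failed, [v] would lie in the set [Z] of points [w <> x] with neither [P w x] nor
    [P u w]. Membership in [Z] is locally constant on [B] and [x] is not in [Z], against
    connectedness. *)
Lemma offdiag_cross (T : topologicalType) (B : set T) (P : T -> T -> Prop) :
  hausdorff_space T -> connected B -> locally_constant_offdiag B P ->
  forall x u v, B x -> B u -> B v -> u <> x -> v <> x ->
    P u x -> ~ P v x -> P u v.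
Proof.
move=> hT cB lcP x u v Bx Bu Bv ux vx Pux Pvx.
pose Z : set T := [set w | [/\ w <> x, ~ P w x & ~ P u w]].
apply: contrapT => Puv.
have Zv : Z v by [].
suff : Z x by case.
apply: (connected_locally_constant cB _ Bv) => // w Bw.
have [->|wx] := pselect (w = x).
  have [[U V] /= [Uu Vx] UV] := lcP u x Bu Bx ux.
  apply: filterS Vx => z Vz Bz; split; last by case.
  move=> [_ _ Puz]; exfalso; apply: Puz.
  by apply/(UV (u, z)) => //; split=> //; exact: nbhs_singleton.
have nwx : \forall z \near w, z <> x.
  have : open (~` [set x]).
    exact/closed_openC/accessible_closed_set1/hausdorff_accessible.
  by rewrite openE; apply.
have [[U V] /= [Uw Vx] UV] := lcP w x Bw Bx wx.
have Pnear : \forall z \near w, B z -> (P z x <-> P w x).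
  apply: filterS Uw => z Uz Bz.
  by apply: (UV (z, x)) => //; split=> //; exact: nbhs_singleton.
have [uw|uw] := pselect (u = w).
  subst w; apply: filterS Pnear => z Pzx Bz.
  by move: (Pzx Bz) => {}Pzx; split=> -[_ h _]; exfalso; tauto.
have [[U' V'] /= [Uu' Vw'] UV'] := lcP u w Bu Bw uw.
have Pnear' : \forall z \near w, B z -> (P u z <-> P u w).
  apply: filterS Vw' => z Vz Bz.
  by apply: (UV' (u, z)) => //; split=> //; exact: nbhs_singleton.
apply: filterS (filterI nwx (filterI Pnear Pnear')) => z [zx [e e']] Bz.
by move: (e Bz) (e' Bz) => {}e {}e'; split=> -[_ h h']; split=> //; tauto.
Qed.

(* Eilenberg: off the diagonal, the square of a connected set is connected up
   to the swap of the two factors. *)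
Lemma offdiag_constant (T : topologicalType) (B : set T) (P : T -> T -> Prop) :
  hausdorff_space T -> connected B -> locally_constant_offdiag B P ->
  (forall x y, P x y -> P y x) ->
  (forall x y, B x -> B y -> x <> y -> P x y) \/
  (forall x y, B x -> B y -> x <> y -> ~ P x y).
Proof.
move=> hT cB lcP Psym.
have lcnP : locally_constant_offdiag B (fun x y => ~ P x y).
  move=> x y Bx By xy; apply: filterS (lcP x y Bx By xy) => p h Ba Bb.
  by rewrite h.
(* Otherwise [offdiag_cross] gives [P u v], and for the negation of [P], with [u] and [v] exchanged,
   it denies [P v u]. *)
have star x u v : B x -> B u -> B v -> u <> x -> v <> x -> P u x -> P v x.
  move=> Bx Bu Bv ux vx Pux; apply: contrapT => Pvx.
  have Puv := offdiag_cross hT cB lcP Bx Bu Bv ux vx Pux Pvx.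
  apply: (offdiag_cross hT cB lcnP Bx Bv Bu vx ux Pvx); last exact: Psym.
  by move=> /(_ Pux).
have [[x [y [Bx By xy Pxy]]]|nP] :=
    pselect (exists x y, [/\ B x, B y, x <> y & P x y]); last first.
  by right=> x y Bx By xy Pxy; apply: nP; exists x, y.
left=> a b Ba Bb ab.
have Pxz z : B z -> z <> x -> P x z.
  by move=> Bz zx; apply/Psym/(star x y) => //; [exact/nesym|exact: Psym].
have [ax|ax] := pselect (a = x); first by subst a; exact/Pxz/nesym.
by apply/Psym/(star a x b) => //; [exact/nesym|exact/nesym|exact: Pxz].
Qed.

(** * Overlaps of sets of equal measure; negligible compact sets *)

(** Pigeonhole: if the sets were pairwise disjoint, [n] of them would have total mass [n] times [c],
    which exceeds [mu setT] for large [n]. *)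
Lemma equal_measure_overlap d (T : measurableType d) (R : realType)
    (mu : {measure set T -> \bar R}) (E : nat -> set T) (c : \bar R) :
  (mu setT < +oo)%E -> (0 < c)%E ->
  (forall n, measurable (E n)) -> (forall n, mu (E n) = c) ->
  exists m n, (m < n)%N /\ E m `&` E n !=set0.
Proof.
move=> muT c0 mE muE; apply: contrapT => disj.
have tE : trivIset setT E.
  apply/trivIsetP => i j _ _; rewrite neq_ltn => ij; apply/eqP/negPn/negP.
  move=> /set0P ne; apply: disj.
  by case/orP: ij => ij; [exists i, j|exists j, i; rewrite setIC].
have le_c n : (\sum_(i < n) c <= mu setT)%E.
  rewrite -(eq_bigr _ (fun (i : 'I_n) _ => muE i)).
  rewrite -(measure_bigsetU mu mE tE) le_measure ?inE//.
  exact: bigsetU_measurable.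
have cfin : c \is a fin_num.
  rewrite ge0_fin_numE ?(ltW c0)//.
  by move: (le_c 1%N); rewrite big_ord1 => /le_lt_trans; apply.
have muTfin : mu setT \is a fin_num by rewrite ge0_fin_numE.
move: c0 le_c; rewrite -(fineK cfin) -(fineK muTfin) lte_fin.
move: (fine c) (fine (mu setT)) => {cfin} r s r0 rs.
have sr : s / r < (Num.truncn (s / r)).+1%:R by exact: truncnS_gt.
have := rs (Num.truncn (s / r)).+1; rewrite sumEFin lee_fin sumr_const card_ord.
by rewrite leNgt -mulr_natl -ltr_pdivrMr// sr.
Qed.

(** If [K] were not negligible, the sets with negligible complement in [K] would form a proper
    filter. It would cluster at a point of [K], but the complement of the given neighborhood [U] of
    that point belongs to the filter and misses [U]. *)
Lemma negligible_compact (R : realType) (X : ptopologicalType)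
    (mu : {measure set (g_sigma_algebraType (@open X)) -> \bar R}) (K : set X) :
  compact K ->
  (forall x, K x -> exists2 U, nbhs x U & mu.-negligible (K `&` U)) ->
  mu.-negligible K.
Proof.
move=> cK nullK; apply: contrapT => nK.
pose F : set_system X := [set A | mu.-negligible (K `\` A)].
have FF : ProperFilter F.
  split; first by rewrite /F /= setD0.
  split; rewrite /F /=.
  - by rewrite setDT; exact: negligible_set0.
  - move=> A B nA nB; apply: negligibleS (negligibleU nA nB).
    by rewrite -setDIr.
  - move=> A B AB; apply: negligibleS; exact: setDS.
have [x [Kx clx]] : K `&` cluster F !=set0.
  by apply: cK; rewrite /F /= setDv; exact: negligible_set0.
have [U Ux nKU] := nullK x Kx.
have [y [/= Uy]] : ~` U `&` U !=set0.
  by apply: clx => //; rewrite /F /= setDE setCK.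
exact.
Qed.

(** Pigeonhole for the rectangles with sides [A n] and [B n] under the product measure; this yields
    the same indices [m], [n] for both sequences. *)
Lemma equal_measure_overlap2 d (T : measurableType d) (R : realType)
    (P : probability T R) (A B : nat -> set T) (a b : \bar R) :
  (0 < a)%E -> (0 < b)%E ->
  (forall n, measurable (A n)) -> (forall n, measurable (B n)) ->
  (forall n, P (A n) = a) -> (forall n, P (B n) = b) ->
  exists m n, [/\ (m < n)%N, A m `&` A n !=set0 & B m `&` B n !=set0].
Proof.
move=> a0 b0 mA mB PA PB.
have PPE C D : measurable C -> measurable D ->
    (P \x P)%E (C `*` D) = (P C * P D)%E.
  exact: (@product_measure1E _ _ _ _ _ P P).
have [||n|n|m [n [mn [[x y] [[/= Ax By] [/= Ax' By']]]]]] :=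
    @equal_measure_overlap _ _ R (P \x P)%E (fun n => A n `*` B n) (a * b)%E.
- rewrite -setXTT; move: (PPE _ _ measurableT measurableT).
  rewrite probability_setT mule1 => PP1.
  by apply: (@le_lt_trans _ _ 1%E); [rewrite -PP1|exact: ltry].
- by rewrite mule_gt0.
- exact: measurableX.
- by apply: etrans (PPE _ _ (mA n) (mB n)) _; rewrite PA PB.
by exists m, n; split=> //; [exists x|exists y].
Qed.

(** * Borel sets and continuity of the semiflow *)

Lemma open_borel (X : ptopologicalType) (U : set X) :
  open U -> measurable (U : set (g_sigma_algebraType (@open X))).
Proof. by move=> oU; exact: sub_sigma_algebra. Qed.

Lemma closed_borel (X : ptopologicalType) (F : set X) :
  closed F -> measurable (F : set (g_sigma_algebraType (@open X))).
Proof.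
move=> cF; rewrite -(setCK F); apply: measurableC; apply: open_borel.
exact: closed_openC.
Qed.

Lemma semiflow_continuous (R : realType) (X : normedModType R)
    (Phi : R -> X -> X) (t : R) :
  semiflow Phi -> 0 <= t -> continuous (Phi t).
Proof.
move=> [/subspace_continuousP cPhi _ _] t0 x.
move: (cPhi (t, x) t0) => /=; apply: cvg_trans.
move=> A /= [[U V] /= [Ut Vx] UVA].
apply: filterS Vx => y Vy.
by apply: (UVA (t, y)) => //; split=> //; exact: nbhs_singleton.
Qed.

Lemma semiflow_orbit_continuous (R : realType) (X : normedModType R)
    (Phi : R -> X -> X) (x : X) :
  semiflow Phi -> {within [set s : R | 0 <= s], continuous (Phi ^~ x)}.
Proof.
move=> [/subspace_continuousP cPhi _ _]; apply/subspace_continuousP => t t0.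
move: (cPhi (t, x) t0) => /=; apply: cvg_trans.
move=> A /= [[U V] /= [Ut Vx] UVA].
apply: filterS Ut => s Us s0.
by apply: (UVA (s, x)) => //; split=> //; exact: nbhs_singleton.
Qed.

(** * Support of an invariant measure: full mass and invariance *)

Section invariant_measure_theory.
Variables (R : realType) (X : normedModType R) (Phi : R -> X -> X).
Variable mu : probability (g_sigma_algebraType (@open X)) R.
Hypothesis hPhi : semiflow Phi.
Hypothesis hmu : invariant_measure Phi mu.

Lemma supp_closed : closed (supp mu).
Proof. by apply: open_closedC; apply: bigcup_open => U []. Qed.

Lemma supp_open_neq0 (x : X) (U : set X) :
  supp mu x -> open U -> U x -> mu U != 0%E.
Proof. by move=> sx oU Ux; apply/eqP => U0; apply: sx; exists U. Qed.

Lemma supp_sub (F : set X) :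
  closed F -> mu.-negligible (~` F) -> supp mu `<=` F.
Proof.
move=> cF nF x sx; apply: contrapT => nFx.
have oF : open (~` F) by exact: closed_openC.
have := supp_open_neq0 sx oF nFx.
by rewrite (measure_negligible (open_borel oF) nF) eqxx.
Qed.

(** The null open sets outside the support may be uncountably many, so countable additivity does not
    suffice. The part of [K] outside each [S n] is compact and locally null, and these parts exhaust
    [K] off the support. *)
Lemma negligible_setC_supp (K : set X) :
  compact K -> mu.-negligible (~` K) -> mu.-negligible (~` supp mu).
Proof.
move=> cK nK.
pose S n := \bigcup_(b in supp mu) ball b (n.+1%:R^-1 : R).
have nKS n : mu.-negligible (K `\` S n).
  have cKS : compact (K `\` S n).
    rewrite setDE; apply: compact_closedI => //; apply: open_closedC.
    by apply: bigcup_open => b _; exact: ball_open.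
  apply: negligible_compact => // x [_ nSx].
  have : ~ supp mu x by move=> sx; apply: nSx; exists x => //; exact: ballxx.
  move=> /contrapT [U [oU U0] Ux]; exists U; first exact: open_nbhs_nbhs.
  by exists U; split=> //; exact: open_borel.
apply: negligibleS (negligibleU nK (negligible_bigcup nKS)) => x nsx.
have [Kx|] := pselect (K x); last by left.
right; have /nbhs_ballP[e /= e0 xe] : nbhs x (~` supp mu).
  by apply: open_nbhs_nbhs; split=> //; exact: closed_openC supp_closed.
have [n _ /(_ n (leqnn n)) ne] := near_infty_natSinv_lt (PosNum e0).
exists n => //; split=> // -[b sb] /ball_sym/(le_ball (ltW ne)) xb.
exact: xe xb sb.
Qed.

(** Preimages of null open sets are null and open, hence forward invariance. Conversely, the image
    of the compact support is closed and of full mass, so it contains the support. *)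
Lemma supp_invariant (K : set X) :
  compact K -> mu.-negligible (~` K) -> flow_invariant Phi (supp mu).
Proof.
move=> cK nK t t0.
have cPhi := semiflow_continuous hPhi t0.
have cS : compact (supp mu).
  apply: (subclosed_compact supp_closed cK); apply: supp_sub => //.
  exact: compact_closed.
apply/seteqP; split=> [_ [x sx <-]|].
  move=> [U [oU U0] /= Ux]; apply: sx.
  exists (Phi t @^-1` U) => //; split.
    by apply: open_comp => // z _; exact: cPhi.
  by rewrite hmu//; exact: open_borel.
have cI : closed (Phi t @` supp mu).
  apply: compact_closed; first exact: norm_hausdorff.
  by apply: continuous_compact => //; exact: continuous_subspaceT.
apply: supp_sub => //.
have mI : measurable
    (~` (Phi t @` supp mu) : set (g_sigma_algebraType (@open X))).
  by apply: measurableC; exact: closed_borel.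
apply/negligibleP => //; apply: etrans (esym (hmu mI t0)) _.
apply: measure_negligible.
  apply: open_borel; apply: open_comp; last exact: closed_openC.
  by move=> z _; exact: cPhi.
apply: negligibleS (negligible_setC_supp cK nK) => x /= nx sx.
by apply: nx; exists x.
Qed.

(** Orbit segments are connected and stay in the support, so a point and its images share a
    component. *)
Lemma component_invariant (B : set X) :
  flow_invariant Phi (supp mu) -> is_component (supp mu) B ->
  flow_invariant Phi B.
Proof.
move=> sI [x0 sx0 ->] t t0.
have orbit x s : supp mu x -> 0 <= s ->
    connected_component (supp mu) x (Phi s x).
  move=> sx s0; have [_ Phi0 _] := hPhi.
  apply: (@connected_component_max _ _ (Phi ^~ x @` `[0, s])).
  - by exists 0; rewrite ?Phi0//= in_itv/= lexx s0.
  - move=> _ [r + <-]; rewrite /= in_itv/= => /andP[r0 _].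
    by rewrite -(sI r r0); exists x.
  - apply: connected_continuous_connected; first exact: segment_connected.
    apply: (@continuous_subspaceW _ _ _ [set r : R | 0 <= r]);
      last exact: semiflow_orbit_continuous.
    by move=> r; rewrite /= in_itv/= => /andP[].
  - by exists s; rewrite //= in_itv/= lexx s0.
apply/seteqP; split=> [_ [x Bx <-]|y By].
  apply: (connected_component_trans Bx); apply: orbit => //.
  exact: connected_component_sub Bx.
have [x sx xy] : (Phi t @` supp mu) y.
  by rewrite sI//; exact: connected_component_sub By.
exists x => //.
apply: (connected_component_trans By); apply: connected_component_sym.
by rewrite -xy; exact: orbit.
Qed.

(** A large ball carries nearly all the mass and is eventually mapped into the neighborhood [N e] of
    [G]; by invariance the mass outside [N e] is arbitrarily small, hence zero. The sets [N e]
    shrink to [G], which is closed. *)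
Lemma attractor_full (G : set X) :
  global_attractor Phi G -> mu.-negligible (~` G).
Proof.
move=> [[g0 Gg0] cG _ hG].
pose N (e : R) := \bigcup_(b in G) ball b e.
have oN e : open (N e) by apply: bigcup_open => b _; exact: ball_open.
have mNC e : measurable (~` N e : set (g_sigma_algebraType (@open X))).
  by apply: measurableC; exact: open_borel.
pose D n : set (g_sigma_algebraType (@open X)) := ~` ball (0 : X) (n.+1%:R : R).
have mD n : measurable (D n).
  by apply: measurableC; apply: open_borel; exact: ball_open.
have D0 : mu (D n) @[n --> \oo] --> 0%E.
  have D0 : \bigcap_n D n = set0.
    apply/seteqP; split=> // x Dx; apply: (Dx (Num.truncn `|x|)) => //.
    by rewrite /= -ball_normE /ball_/= sub0r normrN truncnS_gt.
  rewrite -(measure0 mu) -D0; apply: nonincreasing_cvg_mu => //.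
  - by rewrite -ge0_fin_numE// fin_num_measure.
  - by rewrite D0; exact: measurable0.
  - move=> m n mn; apply/subsetPset; apply: subsetC; apply: le_ball.
    by rewrite ler_nat ltnS.
have N0 (e : R) : 0 < e -> mu (~` N e) = 0%E.
  move=> e0; apply/eqP; rewrite eq_le measure_ge0 andbT.
  apply: (cvge_to_ge D0); apply: nearW => n.
  have bD : bounded_set (ball (0 : X) (n.+1%:R : R)).
    exists n.+1%:R; split; first exact: num_real.
    move=> r nr x; rewrite /= -ball_normE /ball_/= sub0r normrN => /ltW.
    by move=> /le_trans; apply; exact: ltW.
  have Dn0 : ball (0 : X) (n.+1%:R : R) !=set0 by exists 0; exact: ballxx.
  have He : \forall s \near (0%E : \bar R), (s < e%:E)%E.
    by apply: open_ereal_lt'; rewrite lte_fin.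
  have Ge : \forall t \near (+oo : set_system R), (ereal_sup [set ereal_inf
      [set (`|a - b|)%:E | b in G]
      | a in Phi t @` ball (0%R : X) n.+1%:R%R] < e%:E)%E.
    exact: (hG _ bD Dn0 _ He).
  have [t [/= te t0]] := filter_ex (filterI Ge (nbhs_pinfty_ge (num_real 0))).
  rewrite -(hmu (mNC e) t0) le_measure ?inE//.
    apply: measurableC; apply: open_borel; apply: open_comp (oN e) => z _.
    exact: semiflow_continuous.
  apply: subsetC => x Dx; have : (ereal_inf
      [set (`|Phi t x - b|)%:E | b in G] < e%:E)%E.
    apply: le_lt_trans te; apply: ereal_sup_ubound.
    by exists (Phi t x) => //; exists x.
  move=> /ereal_inf_lt[_ [b Gb <-]]; rewrite lte_fin => be; exists b => //.
  by rewrite -ball_normE /ball_/= distrC.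
apply: (negligibleS _ (negligible_bigcup
  (fun n => (negligibleP _ (mNC n.+1%:R^-1)).2 (N0 _ _)))); last by [].
move=> x nGx.
have /nbhs_ballP[e /= e0 xe] : nbhs x (~` G).
  apply: open_nbhs_nbhs; split=> //; apply: closed_openC.
  by apply: compact_closed => //; exact: norm_hausdorff.
have [n _ /(_ n (leqnn n)) ne] := near_infty_natSinv_lt (PosNum e0).
exists n => //; move=> -[b Gb] /ball_sym/(le_ball (ltW ne)) xb.
exact: xe xb Gb.
Qed.

(** * Recurrence of pairs and of points *)

Lemma semiflow_measurable (t : R) (A : set (g_sigma_algebraType (@open X))) :
  0 <= t -> measurable A ->
  measurable (Phi t @^-1` A : set (g_sigma_algebraType (@open X))).
Proof.
move=> t0 mA; rewrite -[X in measurable X]setTI.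
have mPhi : measurable_fun [set: g_sigma_algebraType (@open X)]
    (Phi t : g_sigma_algebraType (@open X) -> g_sigma_algebraType (@open X)).
  apply: (measurability (@open X : set (set (g_sigma_algebraType (@open X))))).
    by [].
  move=> _ [U oU <-]; rewrite setTI; apply: open_borel; apply: open_comp => //.
  by move=> z _; exact: semiflow_continuous.
exact: mPhi.
Qed.

Lemma pair_recurrence (A B : set (g_sigma_algebraType (@open X))) (t0 : R) :
  measurable A -> measurable B -> mu A != 0%E -> mu B != 0%E -> 0 < t0 ->
  exists a b t, [/\ t0 <= t, A a, B b, A (Phi t a) & B (Phi t b)].
Proof.
move=> mA mB A0 B0 t0_gt0.
have tn_ge0 n : 0 <= n%:R * t0 by rewrite mulr_ge0 ?ler0n// ltW.
have [||n|n|n|n|m [n [mn [a [/= Aa Aa']] [b [/= Bb Bb']]]]] :=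
    @equal_measure_overlap2 _ _ _ mu (fun n => Phi (n%:R * t0) @^-1` A)
      (fun n => Phi (n%:R * t0) @^-1` B) (mu A) (mu B).
- by rewrite lt0e A0 measure_ge0.
- by rewrite lt0e B0 measure_ge0.
- exact: semiflow_measurable.
- exact: semiflow_measurable.
- exact: hmu.
- exact: hmu.
(* The preimages at times [m * t0] and [n * t0] overlap for both sets, so the points taken at time
   [m * t0] return together after a time of at least [t0]. *)
exists (Phi (m%:R * t0) a), (Phi (m%:R * t0) b), ((n - m)%:R * t0).
have [_ _ PhiD] := hPhi.
have e c : Phi ((n - m)%:R * t0) (Phi (m%:R * t0) c) = Phi (n%:R * t0) c.
  by rewrite PhiD// -mulrDl -natrD subnK// ltnW.
by split; rewrite ?e// ler_peMl ?ler1n ?subn_gt0// ltW.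
Qed.

(** The sets [A n], of points that after time [n + 1] never come closer than [1/(n + 1)] to
    themselves, cover the nonrecurrent points. Recurrence makes each null on small balls, hence on
    [K], so the open complement of the Birkhoff center is null and misses the support. *)
Lemma supp_birkhoff (K : set X) :
  compact K -> mu.-negligible (~` K) -> supp mu `<=` birkhoff_center Phi.
Proof.
move=> cK nK.
pose A (n : nat) : set X :=
  [set x | forall s : R, n.+1%:R <= s -> n.+1%:R^-1 <= `|Phi s x - x|].
have n1_gt0 n : 0 < n.+1%:R :> R by rewrite ltr0n.
have cA n : closed (A n).
  have -> : A n = \bigcap_(s in [set s : R | n.+1%:R <= s])
      [set x | n.+1%:R^-1 <= `|Phi s x - x|] by [].
  apply: closed_bigI => s /= ns.
  have s0 : 0 <= s by apply: le_trans ns.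
  apply: (@closed_comp _ _ (fun x => `|Phi s x - x|) [set r | n.+1%:R^-1 <= r]).
    move=> x _; apply: cvg_norm; apply: cvgB; last exact: cvg_id.
    exact: semiflow_continuous.
  exact: closed_ge.
have nKA n : mu.-negligible (K `&` A n).
  apply: negligible_compact; first exact: compact_closedI.
  move=> x _; pose e : R := n.+1%:R^-1 / 2.
  have e0 : 0 < e by rewrite divr_gt0// invr_gt0.
  exists (ball x e); first exact: nbhsx_ballx.
  pose E : set (g_sigma_algebraType (@open X)) := A n `&` ball x e.
  have mE : measurable E.
    apply: measurableI; first exact: closed_borel.
    by apply: open_borel; exact: ball_open.
  suff E0 : mu E = 0%E by exists E; split=> // y [[_ Ay] xy].
  apply/eqP; apply: contrapT => /negP E0.
  have [a [_ [t [nt [Aa ax] _ [_ atx] _]]]] :=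
    pair_recurrence mE mE E0 E0 (n1_gt0 n).
  have := Aa t nt; apply/negP; rewrite -ltNge distrC.
  move: ax atx; rewrite -ball_normE /ball_/= => ax atx.
  rewrite (splitr n.+1%:R^-1) (le_lt_trans (ler_distD x _ _))//.
  by rewrite ltrD// distrC.
move=> x sx; apply: contrapT => nx.
have oU : open (~` birkhoff_center Phi).
  by apply: closed_openC; exact: closed_closure.
have := supp_open_neq0 sx oU nx; apply/negP; rewrite negbK; apply/eqP.
apply: measure_negligible; first exact: open_borel.
apply: negligibleS (negligibleU nK (negligible_bigcup nKA)) => y ny.
have [Ky|] := pselect (K y); last by left.
right; have [t [t0 nty]] : exists t : R, 0 <= t /\
    ~ closure (\bigcup_(s in [set s : R | t <= s]) [set Phi s y]) y.
  apply: contrapT => h; apply: ny; apply: subset_closure => t /= t0.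
  by apply: contrapT => nty; apply: h; exists t.
have [U Uy disj] : exists2 U, nbhs y U & forall s, t <= s -> ~ U (Phi s y).
  apply: contrapT => h; apply: nty => U Uy; apply: contrapT => nU; apply: h.
  by exists U => // s ts Us; apply: nU; exists (Phi s y); split=> //; exists s.
have /nbhs_ballP[e /= e0 ye] := Uy.
have [m _ me] := near_infty_natSinv_lt (PosNum e0).
(* Large enough to pass the time [t] after which the orbit of [y] avoids [U], and to make
   [1/(n + 1)] smaller than [e]. *)
pose n := (m + Num.truncn t)%N.
have tn : t <= n.+1%:R.
  by rewrite (le_trans (ltW (truncnS_gt t)))// ler_nat ltnS leq_addl.
exists n => //; split=> // s ns; rewrite leNgt; apply/negP => lt_s.
apply: (disj s (le_trans tn ns)); apply: ye.
rewrite -ball_normE /ball_/= distrC; apply: (lt_trans lt_s).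
exact: me (leq_addr _ _).
Qed.


(** * The dichotomy for one invariant cone *)

Lemma near_sub (f : X -> X) (a b : X) (A : set X) :
  continuous f -> nbhs (f a - f b) A ->
  \forall u \near a & v \near b, A (f u - f v).
Proof.
move=> cf nA; have cD : (fun p : X * X => f p.1 - f p.2) @ (a, b) --> f a - f b.
  apply: cvgB.
    by apply: (@cvg_comp _ _ _ fst f _ (nbhs a)); [exact: cvg_fst|exact: cf].
  by apply: (@cvg_comp _ _ _ snd f _ (nbhs b)); [exact: cvg_snd|exact: cf].
exact: cD nA.
Qed.

Lemma cone_locally_constant (C : set X) (ts : R) :
  closed C -> UESM Phi C -> 0 <= ts ->
  (forall x y, C (x - y) -> forall t, ts <= t -> C (Phi t x - Phi t y)) ->
  locally_constant_offdiag (supp mu) (fun x y => C (x - y)).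
Proof.
move=> cC [T T0 hT] ts0 hts x y sx sy xy.
have notC_near a b : ~ C (a - b) -> \forall u \near a & v \near b, ~ C (u - v).
  move=> nC; apply: (@near_sub id a b (~` C)); first by move=> ?; exact: cvg_id.
  by apply: open_nbhs_nbhs; split=> //; exact: closed_openC.
have [Cxy|nCxy] := pselect (C (x - y)); last first.
  by apply: filterS (notC_near x y nCxy) => p np _ _; split=> // /np.
have : \forall a \near x & b \near y, interior C (Phi T a - Phi T b).
  have iC : interior C (Phi T x - Phi T y).
    apply: hT => //; split=> //= xy0; apply: xy.
    by apply/eqP; rewrite -subr_eq0; apply/eqP.
  apply: near_sub; first exact: semiflow_continuous (ltW T0).
  by apply: open_nbhs_nbhs; split=> //; exact: open_interior.
move=> [[U V] /= [Ux Vy] UV].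
exists (interior U, interior V).
  by split=> /=; exact: nbhs_interior.
move=> [a b] /= [Ua Vb] sa sb; split=> // _; apply: contrapT => nCab.
have [[U' V'] /= [Ua' Vb'] UV'] := notC_near a b nCab.
(* Pairs starting in [U] and [V] have difference in [C] from time [T + ts] on; a return to [U'] and
   [V'], where differences avoid [C], is then absurd. *)
have oA : open (interior U `&` interior U').
  by apply: openI; exact: open_interior.
have oB : open (interior V `&` interior V').
  by apply: openI; exact: open_interior.
have [u [v [t [tTs [Uu Uu'] [Vv Vv'] [_ Ut] [_ Vt]]]]] :=
  pair_recurrence (open_borel oA) (open_borel oB)
    (supp_open_neq0 sa oA (conj Ua Ua')) (supp_open_neq0 sb oB (conj Vb Vb'))
    (ltr_wpDr ts0 T0).
apply: (UV' (Phi t u, Phi t v)).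
  by split; apply: interior_subset.
have [_ _ PhiD] := hPhi.
have tT : ts <= t - T by rewrite lerBrDr addrC.
have PhiT c : Phi t c = Phi (t - T) (Phi T c).
  by rewrite PhiD ?subrK// ?(ltW T0)// (le_trans ts0).
rewrite /= !PhiT; apply: hts => //; apply: interior_subset.
exact: UV (u, v) (conj (interior_subset Uu) (interior_subset Vv)).
Qed.

Lemma cone_dichotomy (C B : set X) (ts : R) :
  closed C -> (forall v, C v -> C (- v)) -> UESM Phi C -> 0 <= ts ->
  (forall x y, C (x - y) -> forall t, ts <= t -> C (Phi t x - Phi t y)) ->
  connected B -> B `<=` supp mu -> flow_invariant Phi B ->
  strongly_ordered C B \/ unordered C B.
Proof.
move=> cC CN hC ts0 hts cB sB iB.
have lcB : locally_constant_offdiag B (fun x y => C (x - y)).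
  move=> x y Bx By xy.
  have := cone_locally_constant cC hC ts0 hts (sB _ Bx) (sB _ By) xy.
  by apply: filterS => p h /sB ? /sB ?; exact: h.
have CB x y : C (x - y) -> C (y - x) by move=> /CN; rewrite opprB.
have [oB|] := offdiag_constant (@norm_hausdorff _ X) cB lcB CB; last by right.
(* Preimages at time [T] exist in [B] and are ordered by [C]; flowing them forward lands in the
   interior. *)
left=> x y Bx By xy; have [T T0 hT] := hC.
have [x' Bx' xE] : (Phi T @` B) x by rewrite iB// ltW.
have [y' By' yE] : (Phi T @` B) y by rewrite iB// ltW.
have xy' : x' <> y' by move=> e; apply: xy; rewrite -xE -yE e.
rewrite -xE -yE; apply: hT => //; split; first exact: oB.
by move=> /= /eqP; rewrite subr_eq0 => /eqP.
Qed.
End invariant_measure_theory.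

(** * Projection along a closed subspace of finite codimension *)

(** [p x] is the coordinate vector of the class of [x] modulo [Pi]. Its continuity rests on the
    compactness of the unit sphere of the coordinate space and on the closedness of [Pi]. *)
Lemma codim_projection (R : realType) (X : normedModType R) (Pi : set X)
    (d : nat) :
  closed Pi -> linear_subspace Pi -> has_codim Pi d ->
  exists2 p : X -> 'rV[R]_d, continuous p & forall x y, p x = p y -> Pi (x - y).
Proof.
move=> cPi [Pi0 PiL] [e he].
have PiE a u v : Pi u -> Pi v -> Pi (a *: u + v).
  move=> Pu Pv; have : a *: u + v \in mem Pi by apply: PiL; exact: mem_set.
  exact: set_mem.
pose L (c : 'rV[R]_d) : X := \sum_(i < d) c ord0 i *: e i.
have LD a b c : L (a *: b + c) = a *: L b + L c.
  rewrite /L scaler_sumr -big_split/=; apply: eq_bigr => i _.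
  by rewrite !mxE scalerDl scalerA.
have cL : continuous L.
  rewrite /L; elim: (index_enum _) => [|i s IHs] c.
    under eq_fun do rewrite big_nil.
    exact: cst_continuous.
  under eq_fun do rewrite big_cons.
  have ci : (fun x : 'rV[R]_d => x ord0 i) @ nbhs c --> c ord0 i.
    exact: coord_continuous.
  exact: cvgD (cvgZr_tmp ci) (IHs c).
have [p hp] : exists p : X -> 'rV[R]_d,
    forall x, Pi (x - L (p x)) /\ forall c, Pi (x - L c) -> p x = c.
  exists (fun x => projT1 (cid (he x))) => x.
  by case: cid => c [].
have Pi_p x := (hp x).1.
have p_uniq x c := (hp x).2 c.
have pD a x y : p (a *: x + y) = a *: p x + p y.
  by apply: p_uniq; rewrite LD opprD addrACA -scalerBr; exact: PiE.
have p0 : p 0 = 0.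
  by have := pD (-1) 0 0; rewrite scaleN1r oppr0 addr0 scaleN1r addNr.
have pZ a x : p (a *: x) = a *: p x by have := pD a x 0; rewrite p0 !addr0.
have pB x y : p (x - y) = p x - p y.
  by rewrite addrC -scaleN1r pD scaleN1r addrC.
pose S : set 'rV[R]_d := [set c | `|c| = 1].
have cS : compact S.
  apply: bounded_closed_compact.
    by exists 1; split => // r /ltW r1 c; rewrite /S/= => ->.
  apply: (@closed_comp _ _ (fun c : 'rV[R]_d => `|c|) [set r : R | r = 1]).
    by move=> c _; exact: norm_continuous.
  exact: closed_eq.
have [dl dl0 hdl] : exists2 dl : R, 0 < dl & forall x, `|x| < dl -> `|p x| <> 1.
  (* Otherwise the images of unit norm of vectors tending to [0] cluster at
     some [c] with [L c] in [Pi], hence [c = 0]. *)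
  apply: contrapT => nbnd.
  pose F : set_system 'rV[R]_d := [set A | exists2 dl : R, 0 < dl &
    forall x, `|x| < dl -> `|p x| = 1 -> A (p x)].
  have FF : ProperFilter F.
    split.
      by move=> [dl dl0 hdl]; apply: nbnd; exists dl => // x xdl; exact: hdl.
    split.
    - by exists 1.
    - move=> A B [a a0 hA] [b b0 hB]; exists (Num.min a b).
        by rewrite lt_min a0.
      move=> x; rewrite lt_min => /andP[xa xb] px.
      by split; [exact: hA|exact: hB].
    - by move=> A B AB [a a0 hA]; exists a => // x xa px; apply/AB/hA.
  have FS : F S by exists 1.
  have [c [Sc clc]] := cS F FF FS.
  (* The vectors [L (p x) - x] lie in [Pi] and come arbitrarily close to [L c] for small [x], so
     closedness of [Pi] applies. *)
  have PLc : Pi (L c).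
    apply: cPi => W; rewrite -nbhs_ballE => -[r /= r0 rW].
    have r20 : 0 < r / 2 by rewrite divr_gt0.
    have nc : nbhs c [set c' | ball (L c) (r / 2) (L c')].
      by apply: cL; exact: nbhsx_ballx.
    have Fr : F [set c' | exists x, `|x| < r / 2 /\ c' = p x].
      by exists (r / 2) => // x xr _; exists x.
    have [_ [[x [xr ->]] /= Lx]] := clc _ _ Fr nc.
    exists (L (p x) - x); split.
      have := PiE (-1) _ _ (Pi_p x) (set_mem Pi0).
      by rewrite scaleN1r addr0 opprB.
    apply: rW; rewrite -ball_normE /ball_/= in Lx *.
    rewrite opprB addrCA addrC (splitr r) (le_lt_trans (ler_normD _ _))//.
    by rewrite ltrD.
  have c0 : c = 0.
    rewrite -p0; apply/esym/p_uniq.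
    by have := PiE (-1) _ _ PLc (set_mem Pi0); rewrite scaleN1r addr0 sub0r.
  by move: Sc; rewrite /S/= c0 normr0 => /esym/eqP; rewrite oner_eq0.
(* An image of norm at least [1] could be rescaled to norm exactly [1] by shortening [x]. *)
have hdl1 x : `|x| < dl -> `|p x| < 1.
  move=> xdl; rewrite ltNge; apply/negP => px1.
  have px0 : 0 < `|p x| by exact: lt_le_trans px1.
  apply: (hdl (`|p x|^-1 *: x)).
    rewrite normrZ normfV normr_id; apply: le_lt_trans xdl.
    by rewrite ler_piMl// invf_le1.
  by rewrite pZ normrZ normfV normr_id mulVf// gt_eqF.
exists p; last first.
  move=> x y pxy; have := PiE (-1) _ _ (Pi_p y) (Pi_p x).
  by rewrite scaleN1r pxy opprB addrC subrKA.
move=> x; apply/cvgrPdist_lt => r r0.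
have rdl : 0 < r * dl by rewrite mulr_gt0.
near=> y; have xy : `|x - y| < r * dl by near: y; exact: cvgr_dist_lt.
have : `|r^-1 *: (x - y)| < dl.
  by rewrite normrZ normfV (gtr0_norm r0) ltr_pdivrMl.
move=> /hdl1; rewrite pZ pB normrZ normfV (gtr0_norm r0).
by rewrite ltr_pdivrMl// mulr1.
Unshelve. all: by end_near.
Qed.

(** The part of [A] outside an open set is compact, so its image is closed; this makes the inverse
    continuous. *)
Lemma compact_injection_homeo (T U : topologicalType) (A : set T) (h : T -> U) :
  A !=set0 -> compact A -> hausdorff_space U -> {within A, continuous h} ->
  {in A &, injective h} ->
  exists g : U -> T, homeo_on A (h @` A) h g.
Proof.
move=> [a0 Aa0] cA hU ch inj.
pose g (y : U) : T := xget a0 [set x | A x /\ h x = y].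
have gK x : A x -> g (h x) = x.
  move=> Ax; have [] : A (g (h x)) /\ h (g (h x)) = h x.
    by apply: (@xgetPex _ a0 [set z | A z /\ h z = h x]); exists x.
  by move=> Ag; apply: inj; exact: mem_set.
exists g; split=> //.
- by move=> _ [x Ax <-]; rewrite /= gK.
- by split=> // _ [x Ax <-]; rewrite gK.
apply/subspace_continuousP => _ [x Ax <-] W.
rewrite /from_subspace gK// nbhsE => -[V [oV Vx] VW].
have cAV : compact (A `\` V).
  by rewrite setDE; apply: compact_closedI => //; exact: open_closedC.
have cI : closed (h @` (A `\` V)).
  apply: compact_closed => //; apply: continuous_compact => //.
  by apply: continuous_subspaceW ch => z [].
have : nbhs (h x) (~` (h @` (A `\` V))).
  apply: open_nbhs_nbhs; split; first exact: closed_openC.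
  by move=> [z [Az nVz] hz]; apply: nVz; rewrite (inj z x) ?mem_set.
apply: filterS => y nI [z Az zy]; rewrite /= -zy gK//; apply: VW.
by apply: contrapT => nVz; apply: nI; exists z.
Qed.

(** * Position of a set in the chain of cones *)

Lemma NICs_subset (R : realType) (X : normedModType R) (Phi : R -> X -> X)
    (N : enat) (C : enat -> set X) (i j : enat) :
  NICs Phi N C -> eleq i j -> eleq j N -> C i `<=` C j.
Proof.
move=> [_ _ [_ CN CS] _ _] ij jN.
case: j ij jN => [n|]; last by case: N CN {CS} => //= -> _ _ ?.
case: i => // m; elim: n => [|n IHn] /= mn nN.
  by move: mn; rewrite leqn0 => /eqP ->.
move: mn; rewrite leq_eqVlt => /predU1P[-> //|mn].
apply: subset_trans (CS (Fin n.+1) isT nN); apply: IHn => //.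
by case: N nN {CN CS} => //= k; exact: ltnW.
Qed.

(** Strong ordering passes to larger cones, so [j] is the least positive finite index where it
    holds, or [Infty] if there is none. Below [j] the dichotomy leaves only unorderedness. *)
Lemma NICs_threshold (R : realType) (X : normedModType R) (Phi : R -> X -> X)
    (N : enat) (C : enat -> set X) (B : set X) :
  NICs Phi N C ->
  (forall i, eleq (Fin 1) i -> eltn i N ->
    strongly_ordered (C i) B \/ unordered (C i) B) ->
  exists j : enat,
    [/\ eltn (Fin 0) j, eleq j N,
        forall i, eleq j i -> eleq i N -> strongly_ordered (C i) B
      & forall i, eltn i j -> unordered (C i) B].
Proof.
move=> hC dich; have [N0 _ [C0 CN _] _ _] := hC.
have SO_le i j : eleq i j -> eleq j N ->
    strongly_ordered (C i) B -> strongly_ordered (C j) B.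
  move=> ij jN so x y Bx By xy.
  by apply: (interiorS (NICs_subset hC ij jN)); exact: so.
have SON : strongly_ordered (C N) B by move=> x y _ _ _; rewrite CN interiorT.
have U0 : unordered (C (Fin 0)) B.
  by move=> x y _ _ xy; rewrite C0 => /= /eqP; rewrite subr_eq0 => /eqP.
pose Q n :=
  [&& (0 < n)%N, eleq (Fin n) N & `[< strongly_ordered (C (Fin n)) B >]].
have [exQ|nQ] := pselect (exists n, Q n).
  case: (ex_minnP exQ) => m /and3P[m0 mN /asboolP som] minm.
  exists (Fin m); split=> //; first by rewrite /eltn /= -ltnNge.
    by move=> i mi iN; exact: SO_le mi iN som.
  case=> // -[//|n]; rewrite /eltn /= -ltnNge => nm.
  have nN : eltn (Fin n.+1) N.
    case NE : N mN => [k|//]; rewrite /eltn /= -ltnNge; exact: leq_trans.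
  have [so|//] := dich (Fin n.+1) isT nN.
  have : Q n.+1.
    apply/and3P; split=> //; last exact/asboolP.
    by case: (N) mN => //= k; apply: leq_trans; exact: ltnW.
  by move=> /minm; rewrite leqNgt nm.
(* A finite [N] would itself satisfy [Q], since [C N] is the whole space. *)
have NI : N = Infty.
  case NE : N => [k|//]; case: nQ; exists k; rewrite /Q -NE.
  apply/and3P; split; last exact/asboolP.
    by move: N0; rewrite NE /eltn /= -ltnNge.
  by rewrite NE /=.
exists Infty; split=> //; first by rewrite NI.
  by move=> [//|] _ _; rewrite -NI.
case=> // -[//|n] _; have nN : eltn (Fin n.+1) N by rewrite NI.
have [so|//] := dich (Fin n.+1) isT nN.
by case: nQ; exists n.+1; rewrite /Q/= NI/=; exact/asboolP.
Qed.

(** * Ordering of a component and its embedding by the projection *)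

Unset Implicit Arguments.
Set Strict Implicit.

Theorem theoremC (R : realType) (X : completeNormedModType R)
    (Phi : R -> X -> X) (Gamma : set X) (N : enat) (C : enat -> set X)
    (mu : probability (g_sigma_algebraType (@open X)) R) (B : set X)
    (hPhi : semiflow Phi)
    (hcompact : eventually_compact Phi)
    (hGamma : global_attractor Phi Gamma)
    (hC : NICs Phi N C)
    (hUESM : UESM_NICs Phi N C)
    (hmu : invariant_measure Phi mu)
    (hB : is_component (supp mu) B) :
  (exists j : enat,
     [/\ eltn (Fin 0) j, eleq j N,
         forall i, eleq j i -> eleq i N -> strongly_ordered (C i) B
       & forall i, eltn i j -> unordered (C i) B])
  /\
  (forall (d : nat) (Pi : set X),
     closed Pi -> linear_subspace Pi -> has_codim Pi d ->
     (forall i, eleq (Fin 1) i -> eleq i N ->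
      forall x y, birkhoff_center Phi x -> birkhoff_center Phi y -> x <> y ->
        (forall s : R, 0 < s ->
           exists x' y',
             [/\ birkhoff_center Phi x', birkhoff_center Phi y',
                 Phi s x' = x, Phi s y' = y
               & forall t : R, 0 <= t ->
                   ((C i `\` prev_cone C i) `|` [set 0]) (Phi t x' - Phi t y')]) ->
        ~ Pi (x - y)) ->
     exists K : set 'rV[R]_d,
       [/\ compact K, connected K & homeo_to_invariant Phi B K]).
Proof.
have cG : compact Gamma by case: hGamma.
have nG := attractor_full hPhi hmu hGamma.
have sI := supp_invariant hPhi hmu cG nG.
have iB := component_invariant hPhi sI hB.
have [cB sB closB [b0 Bb0]] :
    [/\ connected B, B `<=` supp mu, closed B & B !=set0].
  case: hB => x sx ->; split.
  - exact: component_connected.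
  - exact: connected_component_sub.
  - by apply: component_closed; exact: supp_closed.
  - by exists x; exact: connected_component_refl.
have compB : compact B.
  apply: (subclosed_compact closB cG); apply: (subset_trans sB).
  by apply: supp_sub => //; apply: compact_closed => //; exact: norm_hausdorff.
have dich i : eleq (Fin 1) i -> eltn i N ->
    strongly_ordered (C i) B \/ unordered (C i) B.
  move=> i1 iN; have [_ _ _ [k [kC _]] inv] := hC.
  have [ts ts0 hts] := inv i i1 iN.
  have [] : closed (C i) /\ forall v, C i v -> C i (- v).
    case: i i1 iN {hts inv} => [n|_]; last by case: (N).
    move=> n0 nN; have [[clC scC _ _] _] := kC n n0 nN; split=> // v.
    by move=> /(scC (-1)); rewrite scaleN1r.
  by move=> clC CN; exact: (cone_dichotomy hPhi hmu clC CN (hUESM i i1 iN) ts0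
    hts cB sB iB).
have [j [j0 jN soj unj]] := NICs_threshold hC dich.
split; first by exists j.
move=> d Pi cPi linPi codPi hPi.
have [p cp pPi] := codim_projection cPi linPi codPi.
have j1 : eleq (Fin 1) j by case: (j) j0 => //= n; rewrite /eltn /= -ltnNge.
have BB : B `<=` birkhoff_center Phi.
  exact: subset_trans sB (supp_birkhoff hPhi hmu cG nG).
(* Strong ordering puts differences in [C j], and unorderedness keeps them out of [prev_cone C j];
   for [j = Infty] a point of the union lies in some finite cone. *)
have diffB x y : B x -> B y -> ((C j `\` prev_cone C j) `|` [set 0]) (x - y).
  move=> Bx By; have [->|xy] := pselect (x = y).
    by right; rewrite /= subrr.
  have jj : eleq j j by case: (j) => /=.
  left; split; first exact: interior_subset (soj j jj jN x y Bx By xy).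
  case: (j) j1 unj => [n n1 unj|_ unj [n _]] /=; apply: unj => //.
  by rewrite /eltn /= -ltnNge ltn_predL.
have injp : {in B &, injective p}.
  move=> x y /set_mem Bx /set_mem By pxy; apply: contrapT => xy.
  (* Only the index [j] is needed: invariance of [B] supplies preimages in [B] for every [s], and
     [diffB] applies along their forward orbits. *)
  apply: (hPi j j1 jN x y (BB _ Bx) (BB _ By) xy _ (pPi _ _ pxy)) => s s0.
  have [x' Bx' xE] : (Phi s @` B) x by rewrite iB// ltW.
  have [y' By' yE] : (Phi s @` B) y by rewrite iB// ltW.
  exists x', y'; split=> //; try exact: BB.
  by move=> t t0; apply: diffB; rewrite -(iB t t0); [exists x'|exists y'].
have cpB : {within B, continuous p} by exact: continuous_subspaceT.
have [|g hg] := compact_injection_homeo _ compB (@norm_hausdorff _ _) cpB injp.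
  by exists b0.
exists (p @` B); split.
- exact: continuous_compact.
- exact: connected_continuous_connected.
exists p, g; split=> //; first by move=> t t0; rewrite iB.
have [_ _ [gp _] _ _] := hg.
move=> t t0; rewrite /transport image_comp; apply/seteqP; split.
  move=> _ [x Bx <-]; rewrite /= gp//; exists (Phi t x) => //.
  by rewrite -(iB t t0); exists x.
move=> _ [x + <-]; rewrite -{1}(iB t t0) => -[z Bz zx].
by exists z => //=; rewrite gp// zx.
Qed.
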